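(* For every density submeasure $\varphi$ on $\omega$ with $\varphi(\omega)=\infty$, the ideal $\mathrm{exh}(\varphi)$ is contained in some summable ideal. Consequently, for every ideal $\mathcal{I}$ on $\omega$, we have $\mathcal{I}\in\mathcal{AN}$ if and only if there is a summable ideal $\mathcal{J}$ with $\mathcal{I}\subseteq\mathcal{J}$.
   Context: Ideals on $\omega$ are proper and contain all finite sets. A density submeasure is $\varphi=\sup_n\mu_n$ with $(\mu_n)$ finitely supported non-negative measures on $\omega$ with pairwise disjoint supports; $\mathrm{exh}(\varphi)=\{A\subseteq\omega\colon\lim_n\varphi(A\setminus[0,n])=0\}$. For $f\colon\omega\to[0,\infty)$ with $\sum_n f(n)=\infty$, the summable ideal is $\mathcal{I}_f=\{A\colon\sum_{n\in A}f(n)<\infty\}$. For an ideal $\mathcal{I}$, let $N_{\mathcal{I}^*}=\omega\cup\{p\}$ be the space with points of $\omega$ isolated and neighborhood base $\{A\cup\{p\}\colon \omega\setminus A\in\mathcal{I}\}$ at $p$. A zero-dimensional space $X$ has the finitely supported Nikodym property if every sequence of finitely supported measures $\mu_n=\sum_{x\in F_n}\alpha_x\delta_x$ (norm $\sum|\alpha_x|$) with $\mu_n(A)\to0$ for every clopen $A\subseteq X$ is norm bounded. $\mathcal{AN}$ is the class of ideals $\mathcal{I}$ on $\omega$ for which $N_{\mathcal{I}^*}$ does not have the finitely supported Nikodym property. *)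

(* Defs.v *)
From HB Require Import structures.
From mathcomp Require Import all_boot all_order all_algebra finmap.
From mathcomp Require Import all_classical all_reals all_analysis.
Set Implicit Arguments.
Unset Strict Implicit.
Unset Printing Implicit Defensive.
Import Order.TTheory GRing.Theory Num.Theory.
Import numFieldNormedType.Exports.
Local Open Scope classical_set_scope.
Local Open Scope ring_scope.

Record ideal := Ideal {
  ideal_sets :> set (set nat);
  ideal_finite : forall A, finite_set A -> ideal_sets A;
  ideal_sub : forall A B, A `<=` B -> ideal_sets B -> ideal_sets A;
  ideal_setU : forall A B, ideal_sets A -> ideal_sets B -> ideal_sets (A `|` B);
  ideal_proper : ~ ideal_sets setT }.

(* [mu : {fsfun X -> R with 0}] stands for the finitely supported signed measure
   \sum_(x <- finsupp mu) mu x * delta_x. *)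
Section finitely_supported_measures.
Context {R : realType} {X : choiceType}.
Implicit Type mu : {fsfun X -> R with 0}.

Definition fsmeas mu (A : set X) : R := \sum_(x <- finsupp mu | x \in A) mu x.

Definition fsnorm mu : R := \sum_(x <- finsupp mu) `|mu x|.

End finitely_supported_measures.

Section ideals_on_nat.
Context (R : realType).

Definition density_submeasure (phi : set nat -> \bar R) : Prop :=
  exists mu : nat -> {fsfun nat -> R with 0},
    [/\ forall n k, 0 <= mu n k,
        trivIset setT (fun n => [set` finsupp (mu n)]) &
        forall A, phi A = ereal_sup (range (fun n => (fsmeas (mu n) A)%:E))].

Definition exh (phi : set nat -> \bar R) : set (set nat) :=
  [set A | phi (A `\` `I_n.+1) @[n --> \oo] --> 0%E].

Definition summable_ideal (J : ideal) : Prop :=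
  exists f : nat -> R,
    [/\ forall n, 0 <= f n,
        (\esum_(n in setT) (f n)%:E = +oo)%E &
        ideal_sets J = [set A | (\esum_(n in A) (f n)%:E < +oo)%E]].

End ideals_on_nat.

(* The space N_{I^*}: [Some n] is the point n of omega and [None] is p. *)
Definition Nspace (I : ideal) : Type := option nat.

Section Nspace_topology.
Context (I : ideal).

HB.instance Definition _ := Choice.on (Nspace I).

Definition Nspace_nbhs (x : Nspace I) : set_system (Nspace I) :=
  if x is Some n then [set U | U (Some n)]
  else filter_from [set A | ideal_sets I (~` A)]
                   (fun A => Some @` A `|` [set None]).

HB.instance Definition _ := hasNbhs.Build (Nspace I) Nspace_nbhs.

Let Nspace_nbhs_filter (x : Nspace I) : ProperFilter (nbhs x).
Proof.
case: x => [n|]; rewrite /nbhs /=.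
  by split=> //=; split=> //= P Q PQ /PQ.
apply: filter_from_proper; last by move=> A _; exists None; right.
apply: filter_from_filter.
  by exists setT => /=; rewrite setCT; exact: ideal_finite.
move=> A B /= IA IB; exists (A `&` B); first by rewrite setCI; exact: ideal_setU.
by move=> _ [[n [An Bn] <-]|->]; split; [left; exists n|left; exists n|right|right].
Qed.

Let Nspace_nbhs_singleton (x : Nspace I) (U : set (Nspace I)) : nbhs x U -> U x.
Proof. by case: x => [n //|[A _]]; apply; right. Qed.

Let Nspace_nbhs_nbhs (x : Nspace I) (U : set (Nspace I)) :
  nbhs x U -> nbhs x (nbhs^~ U).
Proof.
case: x => [n //|[A IA AU]]; exists A => // _ [[n An <-]|->].
  by apply: AU; left; exists n.
by exists A.
Qed.

HB.instance Definition _ := Nbhs_isNbhsTopological.Build (Nspace I)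
  Nspace_nbhs_filter Nspace_nbhs_singleton Nspace_nbhs_nbhs.

Lemma Nspace_clopen_base (x : Nspace I) (U : set (Nspace I)) : nbhs x U ->
  exists V : set (Nspace I), [/\ clopen V, V x & V `<=` U].
Proof.
case: x => [n Un|[A IA AU]].
  exists [set Some n]; split=> // [|_ -> //]; split.
    by rewrite openE => _ -> ; exact: erefl.
  rewrite -openC openE => -[m mn|_]; first exact: mn.
  exists (~` [set n]) => /=; first by rewrite setCK; exact: ideal_finite.
  by move=> _ [[m mn <-]|-> //] [].
exists (Some @` A `|` [set None]); split=> //; last by right.
split.
  by rewrite openE => -[m mA|_]; [exact: mA|exists A].
by rewrite -openC openE => -[m mA|[]]; [exact: mA|right].
Qed.

End Nspace_topology.

(* Meant for zero-dimensional X; see [Nspace_clopen_base] for [Nspace I]. *)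
Definition fs_nikodym (R : realType) (X : topologicalType) : Prop :=
  forall mu : nat -> {fsfun X -> R with 0},
    (forall A : set X, clopen A -> fsmeas (mu n) A @[n --> \oo] --> (0 : R)) ->
    exists M : R, forall n, fsnorm (mu n) <= M.

Definition AN (R : realType) : set ideal := [set I | ~ fs_nikodym R (Nspace I)].

(* Main.v *)
(** For a density submeasure [sup_n mu_n], some subsequence has norms at least
    [2 ^ k.+1]; weighted by [2 ^- k.+1] it adds up to a weight of infinite total
    mass which is finite on every set where the [mu_n] are bounded, in particular
    on [exh].  If [I] is in AN, witnessed by [mu_n], a gliding hump shows that the
    total variations of the [mu_n] are bounded on each member of [I], and the same
    weight works.  Conversely a weight [f] gives the measures
    [f] restricted to [[n, N_n)] minus [f [n, N_n)] times the Dirac mass at p, which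
    vanish in the limit on sets of the summable ideal and on their complements. *)
Require Import Defs.
From HB Require Import structures.
From mathcomp Require Import all_boot all_order all_algebra finmap.
From mathcomp Require Import all_classical all_reals all_analysis.
From mathcomp Require Import lra.
Import Order.TTheory GRing.Theory Num.Theory.
Import numFieldNormedType.Exports.
Local Open Scope classical_set_scope.
Local Open Scope ring_scope.

(** * Weights on omega, their ideals, and the gliding hump *)

Section summable_ideals.
Context {R : realType}.
Implicit Types (f : nat -> R) (A B : set nat).

Lemma esum_natE f A : (forall n, 0 <= f n) ->
  (\esum_(n in A) (f n)%:E = \sum_(n <oo | n \in A) (f n)%:E)%E.
Proof.
by move=> f0; rewrite nneseries_esum ?set_mem_set// => n _; rewrite lee_fin.
Qed.

Lemma esum_fin_supp f A N : (forall n, 0 <= f n) ->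
  (forall n, (N <= n)%N -> f n = 0) ->
  (\esum_(n in A) (f n)%:E = (\sum_(0 <= n < N | n \in A) f n)%:E)%E.
Proof.
move=> f0 fN; rewrite esum_natE// (nneseries_split_cond 0 N); last first.
  by move=> k _; rewrite lee_fin.
rewrite add0n sumEFin [X in (_ + X)%E]eseries0 ?adde0// => k Nk _.
by rewrite fN.
Qed.

Lemma summable_ideal_of_weight f : (forall n, 0 <= f n) ->
  (\esum_(n in setT) (f n)%:E = +oo)%E ->
  exists J : ideal, summable_ideal R J /\
    ideal_sets J = [set A | (\esum_(n in A) (f n)%:E < +oo)%E].
Proof.
move=> f0 foo; have f0E n : (0 <= (f n)%:E)%E by rewrite lee_fin.
pose S := [set A | (\esum_(n in A) (f n)%:E < +oo)%E].
have Ssub A B : A `<=` B -> S B -> S A.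
  move=> AB; apply: le_lt_trans; rewrite esum_mkcond [leRHS]esum_mkcond.
  apply: le_esum => n _; case: ifPn => [/set_mem/AB/mem_set -> //|_].
  by case: ifP.
have SU A B : S A -> S B -> S (A `|` B).
  move=> SA SB; rewrite /S /= (esumID A)//; apply: lte_add_pinfty.
    by apply: Ssub SA => n [].
  by apply: Ssub SB => n [[]].
have Sfin A : finite_set A -> S A.
  by move=> finA; rewrite /S /= esum_fset// fsbig_finite//= sumEFin ltry.
have SnT : ~ S setT by rewrite /S /= foo ltxx.
by exists (Ideal Sfin Ssub SU SnT); split => //; exists f.
Qed.

(** Serves both inclusions into a summable ideal. The bound on each column [m n i] makes the
    weighted sum finite at every point, hence a real weight; the unbounded total masses make its
    ideal proper. *)
Lemma sub_summable_ideal_of_unbounded (m : nat -> nat -> R) :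
  (forall n i, 0 <= m n i) ->
  (forall i, exists M : R, forall n, m n i <= M) ->
  (forall M : R, exists n, (M%:E <= \esum_(i in setT) (m n i)%:E)%E) ->
  exists J : ideal, summable_ideal R J /\ forall A,
    (exists M : R, forall n, (\esum_(i in A) (m n i)%:E <= M%:E)%E) -> ideal_sets J A.
Proof.
move=> m0 mi moo.
have [s sP] := choice (fun k => moo (2 ^ k.+1)%:R).
pose w k : R := (2 ^ k.+1)%:R^-1.
have w0 k : 0 <= w k by rewrite invr_ge0.
have wm0 k i : (0 <= (w k * m (s k) i)%:E)%E by rewrite lee_fin mulr_ge0.
pose F i := (\sum_(k <oo) (w k * m (s k) i)%:E)%E.
have F0 i : (0 <= F i)%E by apply: nneseries_ge0.
(* Tonelli: the weight of [A] is the weighted sum of the masses of [A] under the chosen rows. *)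
have sumF A : (\sum_(i <oo | i \in A) F i =
    \sum_(k <oo) ((w k)%:E * \esum_(i in A) (m (s k) i)%:E))%E.
  rewrite nneseries_interchange//; apply: eq_eseriesr => k _.
  rewrite esum_natE// -nneseriesZl// => i _.
  by rewrite lee_fin.
have bounded_series (u : nat -> \bar R) M : (forall k, 0 <= u k)%E ->
    (forall k, u k <= M%:E)%E -> (\sum_(k <oo) ((w k)%:E * u k) < +oo)%E.
  move=> u0 uM.
  have M0 : 0 <= M by rewrite -lee_fin (le_trans (u0 0%N)).
  apply: (@le_lt_trans _ _ M%:E); last by rewrite ltry.
  apply: le_trans (epsilon_trick0 xpredT M0).
  apply: lee_nneseries => [k _ _|k _]; first by rewrite mule_ge0 ?lee_fin.
  by rewrite mulrC EFinM lee_pmul// lee_fin.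
have Ffin i : F i \is a fin_num.
  have [M mM] := mi i; rewrite ge0_fin_numE//.
  have -> : F i = (\sum_(k <oo) ((w k)%:E * (m (s k) i)%:E))%E by [].
  by apply: (bounded_series _ M) => k; rewrite lee_fin.
pose f i := fine (F i).
have fE i : (f i)%:E = F i by rewrite fineK.
have f0 i : 0 <= f i by rewrite fine_ge0.
have esumf A : (\esum_(i in A) (f i)%:E =
    \sum_(k <oo) ((w k)%:E * \esum_(i in A) (m (s k) i)%:E))%E.
  by rewrite esum_natE// -sumF; apply: eq_eseriesr => i _.
have e0 A k : (0 <= \esum_(i in A) (m k i)%:E)%E.
  by apply: esum_ge0 => i _; rewrite lee_fin.
have [|J [sJ JE]] := summable_ideal_of_weight f f0.
  (* Each of the first [K] terms is at least [w k] times 2^(k+1), that is 1, and [K] exceeds [M]. *)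
  rewrite esumf; apply/eqyP => M _; pose K := (Num.truncn M).+1.
  apply: le_trans (nneseries_lim_ge K _); last first.
    by move=> k _ _; rewrite mule_ge0 ?lee_fin.
  apply: (@le_trans _ _ (\sum_(0 <= k < K) 1%:E)%E).
    rewrite sumEFin lee_fin big_const_nat iter_addr_0 subn0.
    by rewrite ltW// truncnS_gt.
  apply: lee_sum => k _; apply: (@le_trans _ _ ((w k)%:E * (2 ^ k.+1)%:R%:E)%E).
    by rewrite -EFinM mulVf// pnatr_eq0 expn_eq0.
  by rewrite lee_pmul// ?lee_fin// ler0n.
exists J; split => // A [M mM]; rewrite JE /= esumf.
exact: bounded_series.
Qed.

(* Gliding hump: if [\sum_(i in A) `|m n i|] were unbounded, successive intervals
   would carry more and more of the mass of suitable [m n]; taking the positive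
   (resp. negative) points of each interval yields [B, B' `<=` A] on which
   the sums cannot both be bounded. *)
Lemma bounded_variation_of_setwise_bounded (m : nat -> nat -> R) (N : nat -> nat) A :
  (forall n i, (N n <= i)%N -> m n i = 0) ->
  (forall B, B `<=` A -> exists M : R, forall n,
    `|\sum_(0 <= i < N n | i \in B) m n i| <= M) ->
  exists M : R, forall n, \sum_(0 <= i < N n | i \in A) `|m n i| <= M.
Proof.
move=> mN bnd; apply: contrapT => unb.
have {}unb (M : R) : exists n, M < \sum_(0 <= i < N n | i \in A) `|m n i|.
  apply: contrapT => /forallNP h; apply: unb; exists M => n.
  by rewrite leNgt; apply/negP.
(* Singletons of [A] as [B] bound each column, so the variation on the part of [A] below [a] is at
   most [C a], uniformly in [n]. *)
have pt i : exists c : R, 0 <= c /\ (i \in A -> forall n, `|m n i| <= c).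
  have [iA|iA] := boolP (i \in A); last by exists 0.
  have [B iM] := bnd [set i] (fun j (ji : [set i] j) => eq_ind_r A (set_mem iA) ji).
  have B0 : 0 <= B by apply: le_trans (iM 0%N).
  exists B; split => // _ n; have [Ni|iN] := leqP (N n) i.
    by rewrite mN// normr0.
  apply: le_trans (iM n); rewrite (eq_bigl (pred1 i)); last first.
    by move=> j; apply/idP/eqP => [/set_mem|->]; rewrite ?inE.
  by rewrite big_nat1_eq /= iN.
have [c cP] := choice pt.
pose C a := \sum_(0 <= i < a) c i.
have Cbnd a n : \sum_(0 <= i < N n | (i \in A) && (i < a)%N) `|m n i| <= C a.
  rewrite /C (big_nat_widen _ _ _ _ _ (leq_maxl (N n) a)).
  rewrite (big_nat_widen _ _ _ _ _ (leq_maxr (N n) a)).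
  rewrite big_mkcond [leRHS]big_mkcond /=; apply: ler_sum => i _.
  have [c0 cM] := cP i.
  by case: (i < a)%N; rewrite ?andbF//; case: ifP => // /andP[/andP[/cM]].
(* [p.1] is the next row and [p.2] the right end of its interval, past the support of that row. In
   [2 * C a], one [C a] removes the head below [a] from the variation, the other absorbs what
   earlier choices put into [B] and [B'] there. *)
have step a : exists p : nat * nat, [/\ (a < p.2)%N, (N p.1 <= p.2)%N &
    a%:R + 2 * C a < \sum_(0 <= i < N p.1 | i \in A) `|m p.1 i|].
  have [n nP] := unb (a%:R + 2 * C a).
  by exists (n, maxn a.+1 (N n)); rewrite /= leq_maxl leq_maxr.
have [p pP] := choice step.
pose a := fix a k := if k is k'.+1 then (p (a k')).2 else 0%N.
pose s k := (p (a k)).1.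
have aS k : (a k < a k.+1)%N by case: (pP (a k)).
have sN k : (N (s k) <= a k.+1)%N by case: (pP (a k)).
have big k : (a k)%:R + 2 * C (a k) < \sum_(0 <= i < N (s k) | i \in A) `|m (s k) i|.
  by case: (pP (a k)).
have amono : {homo a : i j / (i <= j)%N}.
  by apply: homo_leq => // [i j k|k]; [exact: leq_trans|exact: ltnW].
have ak k : (k <= a k)%N by elim: k => // k IH; exact: leq_ltn_trans (aS k).
pose B := [set i | A i /\ exists k, [/\ (a k <= i)%N, (i < a k.+1)%N & 0 < m (s k) i]].
pose B' := [set i | A i /\ exists k, [/\ (a k <= i)%N, (i < a k.+1)%N & m (s k) i < 0]].
have [M BM] := bnd B (fun i h => h.1).
have [M' BM'] := bnd B' (fun i h => h.1).
have key k : (a k)%:R < M + M'.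
  (* Proved termwise: below [a k] the left term is minus the absolute value; from [a k] on, [B] and
     [B'] collect exactly the positive and negative values, giving equality. *)
  suff h : \sum_(0 <= i < N (s k) | i \in A) `|m (s k) i| -
      2 * \sum_(0 <= i < N (s k) | (i \in A) && (i < a k)%N) `|m (s k) i| <=
      \sum_(0 <= i < N (s k) | i \in B) m (s k) i -
      \sum_(0 <= i < N (s k) | i \in B') m (s k) i.
    have := BM (s k); have := BM' (s k); rewrite !ler_norml => /andP[? ?] /andP[? ?].
    have := big k; have := Cbnd (a k) (s k); lra.
  rewrite big_mkcond [X in 2 * X]big_mkcond /= mulr_sumr -sumrB.
  rewrite [X in _ <= X - _]big_mkcond [X in _ <= _ - X]big_mkcond -sumrB.
  rewrite big_nat_cond [leRHS]big_nat_cond; apply: ler_sum => i /=.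
  rewrite andbT => iN; have {}iN := leq_trans iN (sN k).
  have [iA|iA] := boolP (i \in A); last first.
    have /negbTE -> : i \notin B by apply: contra iA => /set_mem[+ _] => /mem_set.
    have /negbTE -> : i \notin B' by apply: contra iA => /set_mem[+ _] => /mem_set.
    by rewrite /= mulr0 subrr.
  (* The intervals are disjoint, so [i] determines its row and thus its sign. *)
  have BB' : ~ (B i /\ B' i).
    move=> [[_ [j [aj ja mj]]] [_ [l [al la ml]]]].
    have jl : j = l.
      apply/eqP; rewrite eqn_leq; apply/andP; split; rewrite leqNgt; apply/negP => lt.
        by have := leq_trans la (leq_trans (amono _ _ lt) aj); rewrite ltnn.
      by have := leq_trans ja (leq_trans (amono _ _ lt) al); rewrite ltnn.
    by move: mj ml; rewrite jl => /lt_trans h /h; rewrite ltxx.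
  have [ia|ai] := ltnP i (a k); rewrite /=.
    have := ler_norm (m (s k) i); have := ler_norm (- m (s k) i); rewrite normrN.
    by do 2 case: ifP => _; lra.
  rewrite mulr0 subr0; have Ai := set_mem iA.
  have [mi|mi|mi] := ltgtP (m (s k) i) 0.
  - have B'i : B' i by split => //; exists k.
    by rewrite (mem_set B'i) memNset ?sub0r ?ltr0_norm// => Bi; apply: BB'.
  - have Bi : B i by split => //; exists k.
    by rewrite (mem_set Bi) memNset ?subr0 ?gtr0_norm// => B'i; apply: BB'.
  - by rewrite mi normr0; do 2 case: ifP; rewrite subr0.
have [k kM] : exists k : nat, M + M' < k%:R.
  by exists (Num.truncn (M + M')).+1; exact: truncnS_gt.
by have := lt_trans (key k) kM; rewrite ltr_nat ltnNge ak.
Qed.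

End summable_ideals.

(** * Finitely supported measures as finite sums over initial segments *)

Section finitely_supported_measures.
Context {R : realType}.

(** [g] is the identity for [fsmeas] and the absolute value for [fsnorm]; [g 0 = 0] kills the terms
    outside the support. *)
Lemma sum_finsupp_seq (X : choiceType) (mu : {fsfun X -> R with 0}) (P : pred X)
    (g : R -> R) (s : seq X) : g 0 = 0 -> uniq s -> {subset finsupp mu <= s} ->
  \sum_(x <- finsupp mu | P x) g (mu x) = \sum_(x <- s | P x) g (mu x).
Proof.
move=> g0 us sub; rewrite [RHS](bigID (mem (finsupp mu))) /=.
rewrite [X in _ + X]big1 ?addr0; last first.
  by move=> x /andP[_ xmu]; rewrite fsfun_dflt.
rewrite -[LHS]big_filter -[RHS]big_filter; apply: perm_big.
apply: uniq_perm => [||x]; rewrite ?filter_uniq ?fset_uniq//.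
rewrite !mem_filter -andbA; congr (_ && _).
by case: (boolP (x \in finsupp mu)) => [/sub ->|].
Qed.

Lemma fsfun_nat_bound (mu : {fsfun nat -> R with 0}) :
  exists N, forall i, (N <= i)%N -> mu i = 0.
Proof.
exists (\max_(i <- finsupp mu) i).+1 => i Ni; apply: fsfun_dflt.
by apply: contraL Ni => imu; rewrite -ltnNge ltnS leq_bigmax_seq.
Qed.

Lemma fsmeas_natE (mu : {fsfun nat -> R with 0}) N A :
  (forall i, (N <= i)%N -> mu i = 0) ->
  fsmeas mu A = \sum_(0 <= i < N | i \in A) mu i.
Proof.
move=> muN; rewrite /fsmeas (sum_finsupp_seq _ _ _ id (index_iota 0 N)) ?iota_uniq//.
move=> i; rewrite mem_index_iota mem_finsupp /= ltnNge.
by apply: contra => /muN ->.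
Qed.

Lemma esum_fsmeas (mu : {fsfun nat -> R with 0}) A : (forall i, 0 <= mu i) ->
  (\esum_(i in A) (mu i)%:E)%E = (fsmeas mu A)%:E.
Proof.
move=> mu0; have [N muN] := fsfun_nat_bound mu.
by rewrite (esum_fin_supp _ _ N)// (fsmeas_natE _ N).
Qed.

Lemma fsfun_option_bound (mu : {fsfun option nat -> R with 0}) :
  exists N, forall i, (N <= i)%N -> mu (Some i) = 0.
Proof.
exists (\max_(x <- finsupp mu) odflt 0 x)%N.+1 => i Ni; apply: fsfun_dflt.
by apply: contraL Ni => imu; rewrite -ltnNge ltnS (leq_bigmax_seq (Some i)).
Qed.

Lemma sum_finsupp_option (mu : {fsfun option nat -> R with 0}) N
    (P : pred (option nat)) (g : R -> R) : g 0 = 0 ->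
  (forall i, (N <= i)%N -> mu (Some i) = 0) ->
  \sum_(x <- finsupp mu | P x) g (mu x) =
  (if P None then g (mu None) else 0) +
  \sum_(0 <= i < N | P (Some i)) g (mu (Some i)).
Proof.
move=> g0 muN.
rewrite (sum_finsupp_seq _ _ _ _ (None :: map Some (index_iota 0 N)))//.
- by rewrite big_cons big_map; case: ifP; rewrite ?add0r.
- rewrite /= map_inj_uniq ?iota_uniq; last by move=> ? ? [].
  by rewrite andbT; apply/mapP => -[].
move=> [i|]; rewrite mem_finsupp ?mem_head// => mui; rewrite inE /=; apply: map_f.
by rewrite mem_index_iota ltnNge /=; apply: contra mui => /muN ->.
Qed.

Lemma fsmeas_optionE (mu : {fsfun option nat -> R with 0}) N (A : set (option nat)) :
  (forall i, (N <= i)%N -> mu (Some i) = 0) ->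
  fsmeas mu A = (if None \in A then mu None else 0) +
                \sum_(0 <= i < N | Some i \in A) mu (Some i).
Proof. exact: (sum_finsupp_option _ _ _ id). Qed.

Lemma fsnorm_optionE (mu : {fsfun option nat -> R with 0}) N :
  (forall i, (N <= i)%N -> mu (Some i) = 0) ->
  fsnorm mu = `|mu None| + \sum_(0 <= i < N) `|mu (Some i)|.
Proof. by move=> muN; rewrite /fsnorm (sum_finsupp_option _ N) ?normr0. Qed.

End finitely_supported_measures.

(** * Exhaustive ideals of density submeasures *)

Lemma exh_sub_summable_ideal (R : realType) (phi : set nat -> \bar R) :
  density_submeasure phi -> phi setT = +oo%E ->
  exists J : ideal, summable_ideal R J /\ exh phi `<=` J.
Proof.
move=> [mu [mu0 disj phiE]] phioo.
(* Disjoint supports: at most one [mu n] charges [i], and its value there is the bound. *)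
have pt i : exists M, 0 <= M /\ forall n, mu n i <= M.
  have [[n nP]|/forallNP h] := pselect (exists n, mu n i != 0).
    exists (mu n i); split => // k.
    have [->//|k0] := eqVneq (mu k i) 0.
    suff -> : k = n by [].
    by apply: (disj k n) => //; exists i; rewrite /= !mem_finsupp.
  by exists 0; split => // n; have /negP/negPn/eqP -> := h n.
have [|M|J [sJ JP]] := sub_summable_ideal_of_unbounded mu mu0.
- by move=> i; have [M [_ ?]] := pt i; exists M.
- have : (M%:E < phi setT)%E by rewrite phioo ltry.
  rewrite phiE => /ereal_sup_gt[_ [n _ <-] Mn].
  by exists n; rewrite esum_fsmeas// ltW.
exists J; split => // A Aexh; apply: JP.
have [N phiN] : exists N, (phi (A `\` `I_N.+1) < 1%:E)%E.
  have : \forall n \near \oo, (phi (A `\` `I_n.+1) < 1%:E)%E.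
    apply: (Aexh [set x | (x < 1%:E)%E]); apply: open_nbhs_nbhs.
    by split; [exact: open_ereal_lt_ereal|rewrite /= lte_fin ltr01].
  by move=> [N _ h]; exists N; apply: h => /=.
have [c cP] := choice pt.
(* The 1 bounds the mass of [A] beyond [N], the sum of column bounds its mass on [0, N]. *)
exists (1 + \sum_(0 <= i < N.+1) c i) => n.
have mu0E i : (0 <= (mu n i)%:E)%E by rewrite lee_fin.
rewrite (esumID (`I_N.+1))// addeC EFinD leeD//.
  rewrite -setDE esum_fsmeas//; apply: le_trans (ltW phiN).
  by rewrite phiE; apply: ereal_sup_ubound; exists n.
rewrite esum_mkcondl.
have -> : (\sum_(0 <= i < N.+1) c i)%:E = (\esum_(i in `I_N.+1) (c i)%:E)%E.
  rewrite esum_fset//; last by move=> i _; rewrite lee_fin; case: (cP i).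
  by rewrite -fsbig_ord big_mkord sumEFin.
apply: le_esum => i _; have [c0 cM] := cP i.
by case: ifP => _; rewrite lee_fin.
Qed.

(** * Clopen sets missing the point p *)

Section Nspace_clopen.
Context (I : ideal).

(** As [I] is closed under subsets, every subset of a member of [I] becomes a clopen test set, as
    the gliding hump requires. *)
Lemma clopen_Some_image A : ideal_sets I A -> clopen (Some @` A : set (Nspace I)).
Proof.
move=> IA; split.
  by rewrite openE => -[m mA|[]//]; exact: mA.
rewrite -openC openE => -[m mA|_]; first exact: mA.
exists (~` A) => /=; first by rewrite setCK.
by move=> _ [[m mA <-]|->] [k kA]// [km]; apply: mA; rewrite -km.
Qed.

Lemma ideal_clopen_preimage (A : set (Nspace I)) : clopen A -> ~ A None ->
  ideal_sets I (Some @^-1` A).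
Proof.
move=> [_]; rewrite -openC openE => oA An.
have [C IC CA] := oA None An.
apply: ideal_sub IC => i iA iC; have : (~` A) (Some i); last exact.
by apply: CA; left; exists i.
Qed.

End Nspace_clopen.

(** * The class AN and summable ideals *)

Lemma cvg_real_seq_bounded (R : realType) (u : nat -> R) (l : R) :
  u n @[n --> \oo] --> l -> exists M : R, forall n, `|u n| <= M.
Proof.
move=> ul; have /cvg_seq_bounded[M [_ uM]] : cvgn u by apply/cvg_ex; exists l.
by exists (M + 1) => n; apply: uM => //; rewrite ltrDl.
Qed.

Lemma AN_sub_summable_ideal (R : realType) (I : ideal) :
  AN R I -> exists J : ideal, summable_ideal R J /\ I `<=` J.
Proof.
move=> /existsNP[mu /not_implyP[cvg0 unb]].
have bnd A : clopen A -> exists M : R, forall n, `|fsmeas (mu n) A| <= M.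
  by move=> /cvg0/cvg_real_seq_bounded.
have [N muN] := choice (fun n => fsfun_option_bound (mu n)).
pose m n i := mu n (Some i).
have mN n i : (N n <= i)%N -> m n i = 0 by exact: muN.
have bndI A : ideal_sets I A ->
    exists M : R, forall n, (\esum_(i in A) `|m n i|%:E <= M%:E)%E.
  move=> IA.
  have [B BA|M mM] := bounded_variation_of_setwise_bounded m N A mN; last first.
    exists M => n; rewrite (esum_fin_supp _ _ (N n))// ?lee_fin//.
    by move=> i /mN ->; rewrite normr0.
  have [M BM] := bnd _ (clopen_Some_image I B (ideal_sub BA IA)).
  exists M => n; have := BM n; rewrite (fsmeas_optionE _ _ _ (muN n)).
  rewrite memNset ?add0r; last by case.
  rewrite (eq_bigl (fun i => i \in B))// => i; apply/idP/idP => /set_mem.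
    by move=> [j jB [<-]]; exact: mem_set.
  by move=> iB; apply: mem_set; exists i.
have [i|K|J [sJ JP]] := sub_summable_ideal_of_unbounded (fun n i => `|m n i|)
  (fun n i => normr_ge0 (m n i)).
- have [|M mM] := bndI [set i]; first exact: ideal_finite.
  by exists M => n; have := mM n; rewrite esum_set1 lee_fin.
(* If the variations on omega stayed below [K], the bound [M0] on the total mass would give at most
   [M0 + K] at p, hence norms at most [M0 + 2 * K]. *)
- apply: contrapT => /forallNP h.
  have [|M0 TM0] := bnd setT; first exact: clopenT.
  apply: unb; exists (M0 + 2 * K) => n.
  pose T := \sum_(0 <= i < N n) m n i; pose V := \sum_(0 <= i < N n) `|m n i|.
  have VK : V <= K.
    have /negP := h n; rewrite -ltNge (esum_fin_supp _ _ (N n))//; last first.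
      by move=> i /mN ->; rewrite normr0.
    rewrite lte_fin => /ltW; rewrite (eq_bigl xpredT)// => i.
    by rewrite in_setT.
  have TM : `|mu n None + T| <= M0.
    have := TM0 n; rewrite (fsmeas_optionE _ _ _ (muN n)) in_setT.
    by rewrite (eq_bigl xpredT)// => i; rewrite in_setT.
  have TV : `|T| <= V by exact: ler_norm_sum.
  rewrite (fsnorm_optionE _ _ (muN n)); change (`|mu n None| + V <= M0 + 2 * K).
  have := ler_normD (mu n None + T) (- T); rewrite addrK normrN; lra.
by exists J; split => // A /bndI/JP.
Qed.

Lemma summable_ideal_sub_AN (R : realType) (I J : ideal) :
  summable_ideal R J -> I `<=` J -> AN R I.
Proof.
move=> [f [f0 foo JE]] IJ.
have f0E i : (0 <= (f i)%:E)%E by rewrite lee_fin.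
(* Otherwise the tail from [n] would be at most [n], contradicting divergence. *)
have block n : exists N, n%:R <= \sum_(n <= i < N) f i.
  apply: contrapT => /forallNP h.
  have tail : (\sum_(n <= i <oo) (f i)%:E <= n%:R%:E)%E.
    apply: lime_le; first exact: is_cvg_nneseries.
    apply: nearW => N; rewrite sumEFin lee_fin ltW// ltNge; exact/negP.
  have := foo; rewrite -nneseries_esumT// (nneseries_split 0 n)// add0n sumEFin.
  by apply/eqP; rewrite lt_eqF// lte_add_pinfty ?ltry// (le_lt_trans tail)// ltry.
have [N NP] := choice block.
pose S n := \sum_(n <= i < N n) f i.
(* The mass [- S n] at p makes the total mass zero, while the norm is at least [S n], hence at least
   [n]. *)
pose g n (x : Nspace I) : R :=
  if x is Some i then (if (n <= i < N n)%N then f i else 0) else - S n.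
pose nu n : {fsfun Nspace I -> R with 0} :=
  [fsfun x in seq_fset tt (None :: map Some (iota 0 (N n))) => g n x].
have nuE n x : nu n x = g n x.
  rewrite fsfunE; case: ifPn => // ; rewrite seq_fsetE inE /=.
  case: x => //= i; rewrite mem_map; last by move=> ? ? [].
  by rewrite mem_iota add0n /= -leqNgt => Ni; rewrite ltnNge Ni andbF.
have nuN n i : (N n <= i)%N -> nu n (Some i) = 0.
  by rewrite nuE /= => Ni; rewrite ltnNge Ni andbF.
have nuA n A : fsmeas (nu n) A =
    (if None \in A then - S n else 0) + \sum_(n <= i < N n | Some i \in A) f i.
  rewrite (fsmeas_optionE _ _ _ (nuN n)) nuE; congr (_ + _).
  rewrite [RHS](big_nat_widenl _ 0%N)// [LHS]big_mkcond [RHS]big_mkcond /=.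
  apply: eq_big_nat => i /andP[_ iN]; rewrite nuE /= iN andbT.
  by case: (Some i \in A); case: (n <= i)%N.
move=> nik; have [A cA|M nuM] := nik nu; last first.
  pose n := (Num.truncn M).+1; have : n%:R <= M; last first.
    by apply/negP; rewrite -ltNge truncnS_gt.
  apply: le_trans (nuM n); rewrite (fsnorm_optionE _ _ (nuN n)) nuE /= normrN.
  apply: (le_trans (NP n)); apply: le_trans (ler_norm _) _.
  by rewrite lerDl sumr_ge0.
(* Total mass zero: passing to the complement only changes the sign of the measure. *)
wlog nA : A cA / ~ A None.
  move=> wl; have [AN|] := pselect (A None); last exact: wl.
  have cA' : clopen (~` A) by exact: clopenC.
  have := wl _ cA' (fun h => h AN) => /cvgN; rewrite oppr0.
  apply: cvg_trans; apply: near_eq_cvg; apply: nearW => n /=.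
  change (- fsmeas (nu n) (~` A) = fsmeas (nu n) A).
  rewrite !nuA (mem_set AN) memNset; last exact.
  have -> : S n = \sum_(n <= i < N n | Some i \in A) f i +
      \sum_(n <= i < N n | Some i \notin A) f i by exact: bigID.
  rewrite add0r opprD addrAC addNr add0r.
  by congr (- _); apply: eq_bigl => i; rewrite in_setC.
(* The trace of [A] on omega lies in [J], so [nu n] of [A] is at most the tail from [n] of a
   convergent series. *)
have /IJ := ideal_clopen_preimage I A cA nA; rewrite JE /= esum_natE// => fin.
have /fine_cvgP[tfin /cvgr0Pnorm_lt tail] :=
  nneseries_tail_cvg fin (fun k _ => f0E k).
apply/cvgr0Pnorm_lt => e e0; near=> n.
rewrite nuA memNset// add0r ger0_norm ?sumr_ge0//.
apply: (@le_lt_trans _ _ (fine (\sum_(n <= k <oo | k \in Some @^-1` A) (f k)%:E)%E)).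
  rewrite -lee_fin fineK; last by near: n.
  by rewrite -sumEFin; apply: le_trans (nneseries_lim_ge (N n) _) => //.
apply: le_lt_trans (ler_norm _) _; near: n; exact: tail.
Unshelve. all: by end_near.
Qed.

Theorem theorem7p1 (R : realType) :
  (forall phi : set nat -> \bar R,
     density_submeasure phi -> phi setT = +oo%E ->
     exists J : ideal, summable_ideal R J /\ exh phi `<=` J) /\
  (forall I : ideal,
     AN R I <-> exists J : ideal, summable_ideal R J /\ I `<=` J).
Proof.
split=> [phi|I]; first exact: exh_sub_summable_ideal.
split; first exact: AN_sub_summable_ideal.
by move=> [J [sJ IJ]]; exact: summable_ideal_sub_AN sJ IJ.
Qed.
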